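(* A semigroup variety $\mathcal V$ is lower-modular if and only if either $\mathcal V=\mathcal{SEM}$ or $\mathcal V=\mathcal M\vee\mathcal N$ where $\mathcal M$ is one of the varieties $\mathcal T$ or $\mathcal{SL}$, while $\mathcal N$ is a $0$-reduced variety.
   Context: $\mathbf{SEM}$ denotes the lattice of all semigroup varieties (classes of semigroups defined by semigroup identities) ordered by class-theoretical inclusion; $\vee$ and $\wedge$ denote join and meet in this lattice (the join of two varieties is the least variety containing both; the meet is the intersection). An element $x$ of a lattice $\langle L;\vee,\wedge\rangle$ is called lower-modular if for all $y,z\in L$, $x\le y$ implies $x\vee(y\wedge z)=y\wedge(x\vee z)$. A semigroup variety is called lower-modular if it is a lower-modular element of the lattice $\mathbf{SEM}$. $\mathcal T$, $\mathcal{SL}$ and $\mathcal{SEM}$ denote, respectively, the trivial variety (one-element semigroups), the variety of all semilattices (commutative idempotent semigroups), and the variety of all semigroups. For a semigroup word $w$, the symbolic identity $w=0$ denotes the pair of identities $wx=xw=w$, where $x$ is a letter not occurring in $w$. Identities of the form $w=0$, as well as varieties given by a set of such identities, are called $0$-reduced. *)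

(* Defs.v *)
From HB Require Import structures.
From mathcomp Require Import all_boot all_order.
From mathcomp Require Import boolp classical_sets.

Set Implicit Arguments.
Unset Strict Implicit.
Unset Printing Implicit Defensive.

Import Order.TTheory.

Local Open Scope order_scope.
Local Open Scope classical_set_scope.

(* The [semigroupType] of boot/monoid.v cannot be used here: it bundles a
   [choiceType], so the type of all classes of [semigroupType]s lives one
   universe too high to be itself a [latticeType]. *)
Record semigroup := Semigroup {
  carrier :> Type;
  mulS : carrier -> carrier -> carrier;
  mulSA : associative mulS;
  semigroup_nonempty : inhabited carrier }.

(* Elements of the free semigroup on countably many letters: the word
   x0 x1 ... xn is the pair (x0, [:: x1; ...; xn]), hence is never empty. *)
Definition word := (nat * seq nat)%type.

Definition letters (w : word) : seq nat := w.1 :: w.2.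

Definition letter (x : nat) : word := (x, [::]).

Definition catw (u v : word) : word := (u.1, u.2 ++ letters v).

Definition eval (S : semigroup) (phi : nat -> S) (w : word) : S :=
  foldl (@mulS S) (phi w.1) (map phi w.2).

(* The pair (u, v) stands for the identity u = v. *)
Definition identity := (word * word)%type.

Definition satisfies (S : semigroup) (e : identity) : Prop :=
  forall phi : nat -> S, eval phi e.1 = eval phi e.2.

Definition models (Sigma : set identity) : set semigroup :=
  [set S | forall e, Sigma e -> satisfies S e].

Definition is_variety (K : set semigroup) : Prop :=
  exists Sigma : set identity, K = models Sigma.

Record variety := Variety {
  class :> set semigroup;
  classP : is_variety class }.

Lemma variety_inj (V W : variety) : class V = class W -> V = W.
Proof.
case: V W => [V pV] [W pW] /= eVW; case: _ / eVW pW => pW.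
by congr Variety; apply: Prop_irrelevance.
Qed.

HB.instance Definition _ := gen_eqMixin variety.
HB.instance Definition _ := gen_choiceMixin variety.

Definition lev (V W : variety) : bool := `[< V `<=` W >].

Lemma lev_refl : reflexive lev.
Proof. by move=> V; apply/asboolP. Qed.

Lemma lev_anti : antisymmetric lev.
Proof.
move=> V W /andP[/asboolP VW /asboolP WV].
by apply: variety_inj; apply/seteqP.
Qed.

Lemma lev_trans : transitive lev.
Proof.
move=> W V U /asboolP VW /asboolP WU.
by apply/asboolP; apply: subset_trans VW WU.
Qed.

Fact variety_display : Order.disp_t. Proof. exact: Order.Disp tt tt. Qed.

HB.instance Definition _ :=
  Order.Le_isPOrder.Build variety_display variety lev_refl lev_anti lev_trans.

Lemma is_variety_bigcap (F : set (set semigroup)) :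
  F `<=` is_variety -> is_variety (\bigcap_(K in F) K).
Proof.
move=> Fvar.
exists [set e | exists2 Sigma, F (models Sigma) & Sigma e].
apply/seteqP; split=> [S FS e [Sigma FSigma Se]|S Se K FK].
  exact: FS FSigma e Se.
have [Sigma KE] := Fvar _ FK; rewrite KE => e eSigma.
by apply: Se; exists Sigma => //; rewrite -KE.
Qed.

Lemma is_variety_meet (V W : variety) : is_variety (V `&` W).
Proof.
rewrite -bigcap2inE -(bigcap_image _ _ id); apply: is_variety_bigcap.
by move=> _ [[|[|//]] _ <-] /=; apply: classP.
Qed.

Lemma is_variety_smallest (K : set semigroup) :
  is_variety (smallest is_variety K).
Proof. by apply: is_variety_bigcap => L []. Qed.

Definition meetv (V W : variety) : variety := Variety (is_variety_meet V W).

Definition joinv (V W : variety) : variety :=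
  Variety (is_variety_smallest (V `|` W)).

Lemma meetvP (U V W : variety) : (U <= meetv V W) = (U <= V) && (U <= W).
Proof.
apply/asboolP/andP => [UVW|[/asboolP UV /asboolP UW]].
  by split; apply/asboolP => S /UVW[].
by move=> S US; split; [apply: UV|apply: UW].
Qed.

Lemma joinvP (V W U : variety) : (joinv V W <= U) = (V <= U) && (W <= U).
Proof.
apply/asboolP/andP => [VWU|[/asboolP VU /asboolP WU]].
  split; apply/asboolP => S SV; apply: VWU.
  - by apply: sub_smallest SV => T VT; left.
  - by apply: sub_smallest SV => T WT; right.
apply: smallest_sub; first exact: classP.
by move=> S [/VU|/WU].
Qed.

(* The lattice SEM of all semigroup varieties. *)
HB.instance Definition _ :=
  Order.POrder_MeetJoin_isLattice.Build variety_display variety meetvP joinvP.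

Definition lower_modular d (L : latticeType d) (x : L) : Prop :=
  forall y z : L, (x <= y -> x `|` (y `&` z) = y `&` (x `|` z))%O.

Lemma is_variety_trivial :
  is_variety [set S : semigroup | forall a b : S, a = b].
Proof.
exists [set (letter 0, letter 1)]; apply/seteqP; split=> S /=.
  by move=> S1 _ -> phi; apply: S1.
by move=> S1 a b; apply: (S1 _ erefl (fun i => if i is 0 then a else b)).
Qed.

Lemma is_variety_semilattice :
  is_variety
    [set S : semigroup | commutative (@mulS S) /\ idempotent_op (@mulS S)].
Proof.
exists [set e | e = (catw (letter 0) (letter 1), catw (letter 1) (letter 0))
             \/ e = (catw (letter 0) (letter 0), letter 0)].
apply/seteqP; split=> S /=.
  by move=> [mulC mulI] _ [] -> phi; [apply: mulC|apply: mulI].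
move=> Se; split=> [a b|a].
  exact: (Se _ (or_introl erefl) (fun i => if i is 0 then a else b)).
exact: (Se _ (or_intror erefl) (fun=> a)).
Qed.

Lemma is_variety_setT : is_variety [set: semigroup].
Proof. by exists set0; apply/seteqP; split=> S // _ e. Qed.

Definition var_T : variety := Variety is_variety_trivial.
Definition var_SL : variety := Variety is_variety_semilattice.
Definition var_SEM : variety := Variety is_variety_setT.

(* The identities wx = w and xw = w, over all w in W and all letters x not
   occurring in w (the choice of x is immaterial up to renaming). *)
Definition zero_identities (W : set word) : set identity :=
  [set e | exists w x, [/\ W w, x \notin letters w &
     e = (catw w (letter x), w) \/ e = (catw (letter x) w, w)]].

Definition zero_reduced (V : variety) : Prop :=
  exists W : set word, class V = models (zero_identities W).

(* Main.v *)
From HB Require Import structures.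
From mathcomp Require Import all_fingroup.
From mathcomp Require Import all_boot all_order.
From mathcomp Require Import boolp.
Require Import Defs.

(** Write th for the set of identities of V, a fully invariant congruence on
    the free semigroup.  Passing to identities turns joins of varieties into
    intersections and meets into joins of congruences, so V is lower-modular
    iff th /\ (al \/ be) = al \/ (th /\ be) for all fully invariant al <= th
    and all be.  Memberships in meets and joins of varieties are tested on
    syntactic semigroups of languages ([syntS]): the syntactic semigroup of X
    satisfies exactly the identities whose consequences preserve X, which
    replaces every manipulation of chains of al- and be-steps ([holds_meet]).

    Sufficiency.  Joins of lower-modular elements are lower-modular
    ([joinv_lower_modular]), so it is enough to treat a 0-reduced variety and
    the variety SL.  For a 0-reduced variety th identifies exactly the words of
    an ideal I: al-steps happen inside I, so the part of a chain that leaves I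
    is a single be-step between two words of I
    ([zero_reduced_lower_modular]).  For SL, th is equality of contents, and
    only a be containing some identity with different contents is a problem.
    Then the variety of be is periodic and does not contain SL, and there is a
    two-letter word E such that p = E(p, d) holds in it, for every d, as soon
    as p is a side of one of its identities with different contents
    ([exists_absorbing_word]).  Replacing the words w of a chain whose content
    is not the common content of its ends u and v by E(w, u) repairs the
    chain ([semilattice_lower_modular]).

    Necessity.  Let u be nontrivially th-related to v.  If al isolates u, and a
    chain of a be-step, an al-step and a be-step joins u to v, modularity
    forces u to be related by th /\ be to some word other than u
    ([isolated_step]).  Two choices of be are enough.
    - Let be consist of the identities with equal contents that hold in a
      finite group separating all short words: u is be-related to its powers
      u^(k+1), with k a multiple of the order of the group.  Hence u is
      th-related to arbitrarily long words of the same content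
      ([long_mate]).  In particular the words with nontrivial th-class form a
      fully invariant ideal.
    - Let s and t be such words, with the same length and content, and not
      renamings of each other; let be be the largest fully invariant
      congruence that saturates the set of s and t.  It follows that s is
      th-related to t ([moved_same_size]).
    Applying the second fact to txxy and txyy, with new letters x and y
    replaced afterwards by powers of one letter, yields t z^4 = t z^5 in V, so
    that lengths no longer matter, and all words with nontrivial th-class and
    the same content are th-related ([moved_same_content]).  If V contains SL,
    this says that V is the join of SL and the variety where all these words
    are 0; otherwise all these words are th-related, whatever their content
    ([moved_connected]), and V is 0-reduced. *)
Set Implicit Arguments.
Unset Strict Implicit.
Unset Printing Implicit Defensive.

Import Order.TTheory.

(** * Evaluation, substitution and contexts *)
Arguments letters : simpl never.

(** The monoid obtained by adjoining a unit [None] to [S]; in it the value of a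
    word is an iterated product, and factors of words may be empty. *)
Definition omul (S : semigroup) (a b : option S) : option S :=
  match a, b with
  | None, _ => b
  | _, None => a
  | Some x, Some y => Some (mulS x y)
  end.

Lemma omulA S : associative (@omul S).
Proof. by move=> [a|] [b|] [c|] //=; rewrite mulSA. Qed.

Lemma omul1x S : left_id None (@omul S).
Proof. by case. Qed.

Lemma omulx1 S : right_id None (@omul S).
Proof. by case. Qed.

HB.instance Definition _ (S : semigroup) :=
  Monoid.isLaw.Build (option S) None (@omul S)
    (@omulA S) (@omul1x S) (@omulx1 S).

Lemma Some_eval (S : semigroup) (phi : nat -> S) w :
  Some (eval phi w) = \big[@omul S/None]_(x <- letters w) Some (phi x).
Proof.
rewrite /eval /letters; case: w => x s /=; rewrite big_cons.
elim: s (phi x) => [|y s IHs] a /=; first by rewrite big_nil.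
by rewrite IHs big_cons; case: (\big[_/_]_(_ <- _) _) => [b|] //=; rewrite mulSA.
Qed.

Lemma eq_eval (S : semigroup) (phi psi : nat -> S) w :
  {in letters w, phi =1 psi} -> eval phi w = eval psi w.
Proof.
move=> eq_phi; apply: Some_inj; rewrite !Some_eval.
by apply: eq_big_seq => x /eq_phi ->.
Qed.

Lemma letters_catw u v : letters (catw u v) = letters u ++ letters v.
Proof. by []. Qed.

Lemma letters_letter x : letters (letter x) = [:: x].
Proof. by []. Qed.

Lemma letters_inj : injective letters.
Proof. by move=> [x s] [y t] [-> ->]. Qed.

Lemma eval_catw (S : semigroup) (phi : nat -> S) u v :
  eval phi (catw u v) = mulS (eval phi u) (eval phi v).
Proof.
apply: Some_inj; rewrite Some_eval letters_catw big_cat /=.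
by rewrite -!Some_eval.
Qed.

Lemma eval_hom (S S' : semigroup) (h : S -> S') (phi : nat -> S) w :
  {morph h : a b / mulS a b} -> h (eval phi w) = eval (h \o phi) w.
Proof.
move=> hM; case: w => x s; rewrite /eval /=.
by elim: s (phi x) => [|y s IHs] a //=; rewrite IHs hM.
Qed.

Lemma catwA : associative catw.
Proof. by move=> u v w; apply: letters_inj; rewrite !letters_catw catA. Qed.

Definition free : semigroup := Semigroup catwA (inhabits (letter 0)).

(** An endomorphism of the free semigroup is an evaluation in it. *)
Definition subst (f : nat -> word) (w : word) : word := @eval free f w.

Lemma letters_subst f w :
  letters (subst f w) = flatten [seq letters (f x) | x <- letters w].
Proof.
rewrite /subst /eval; case: w => x s; rewrite [in RHS]/letters /=.
elim: s (f x) => [|y s IHs] a; first by rewrite cats0.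
by rewrite [LHS]IHs /= -catA.
Qed.

Lemma eval_subst (S : semigroup) (phi : nat -> S) f w :
  eval phi (subst f w) = eval (eval phi \o f) w.
Proof. exact: (eval_hom (S := free) f w (eval_catw phi)). Qed.

Lemma subst_id w : subst letter w = w.
Proof. by apply: letters_inj; rewrite letters_subst flatten_seq1. Qed.

Lemma size_subst f w : size (letters w) <= size (letters (subst f w)).
Proof.
rewrite letters_subst size_flatten /shape -map_comp sumnE big_map.
rewrite -sum1_size; exact: leq_sum.
Qed.

Definition lcat (g : seq nat) (w : word) : word :=
  if g is x :: g' then (x, g' ++ letters w) else w.

Definition rcat (w : word) (h : seq nat) : word := (w.1, w.2 ++ h).

(** The consequences of an identity [(p, q)] are, up to equivalence closure, the
    pairs [(plug g f h p, plug g f h q)]; the sides [g] and [h] of the context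
    may be empty, so they are sequences of letters. *)
Definition plug (g : seq nat) (f : nat -> word) (h : seq nat) (w : word) :=
  rcat (lcat g (subst f w)) h.

Lemma letters_rcat w h : letters (rcat w h) = letters w ++ h.
Proof. by []. Qed.

Lemma letters_lcat g w : letters (lcat g w) = g ++ letters w.
Proof. by case: g. Qed.

Lemma letters_plug g f h w :
  letters (plug g f h w) = g ++ letters (subst f w) ++ h.
Proof. by rewrite /plug letters_rcat letters_lcat catA. Qed.

Lemma plug_subst f w : plug [::] f [::] w = subst f w.
Proof. by apply: letters_inj; rewrite letters_plug cats0. Qed.

Lemma plug_id w : plug [::] letter [::] w = w.
Proof. by rewrite plug_subst subst_id. Qed.

Lemma size_plug g f h w : size (letters w) <= size (letters (plug g f h w)).
Proof.
rewrite letters_plug !size_cat addnCA.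
by rewrite (leq_trans (size_subst f w)) ?leq_addr.
Qed.

Lemma satisfies_plug (S : semigroup) p q g f h :
  satisfies S (p, q) -> satisfies S (plug g f h p, plug g f h q).
Proof.
move=> Spq phi; apply: Some_inj; rewrite /= !Some_eval !letters_plug !big_cat /=.
by rewrite -!Some_eval !eval_subst Spq.
Qed.

(** * The syntactic semigroup of a language *)
Section Syntactic.
Variable X : word -> Prop.

Definition synt (p q : word) : Prop :=
  forall g h, X (rcat (lcat g p) h) <-> X (rcat (lcat g q) h).

(** A canonical representative of the class of [p]: the quotient is realised as
    a subtype of [word], which keeps its carrier in a universe small enough for
    [semigroup]. *)
Definition synt_repr (p : word) : word := choose (fun q => `[< synt p q >]) p.

Lemma synt_reprP p : synt p (synt_repr p).
Proof. by apply/asboolP/(@chooseP _ (fun q => `[< synt p q >])); apply/asboolP. Qed.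

Lemma eq_synt_repr p q : synt_repr p = synt_repr q <-> synt p q.
Proof.
split=> [eq_pq g h|pq].
  by rewrite (synt_reprP p) eq_pq -(synt_reprP q).
have eq_syntb : (fun r => `[< synt p r >]) =1 (fun r => `[< synt q r >]).
  by move=> r; apply/asboolP/asboolP => pr g h; rewrite -pr pq.
rewrite /synt_repr (eq_choose eq_syntb); apply: choose_id; apply/asboolP => //.
by move=> g h; rewrite pq.
Qed.

Lemma synt_repr_catw p q :
  synt_repr (catw (synt_repr p) (synt_repr q)) = synt_repr (catw p q).
Proof.
apply/eq_synt_repr => g h.
have assocl u v : rcat (lcat g (catw u v)) h = rcat (lcat g u) (letters v ++ h).
  by apply: letters_inj; rewrite !(letters_rcat, letters_lcat, letters_catw, catA).
have assocr u v : rcat (lcat g (catw u v)) h = rcat (lcat (g ++ letters u) v) h.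
  by apply: letters_inj; rewrite !(letters_rcat, letters_lcat, letters_catw, catA).
by rewrite assocl -synt_reprP -assocl assocr -synt_reprP -assocr.
Qed.

Lemma synt_reprK p : synt_repr (synt_repr p) = synt_repr p.
Proof. by apply/eq_synt_repr => g h; rewrite -synt_reprP. Qed.

Definition synt_quot := {p : word | synt_repr p = p}.

Definition synt_pi (p : word) : synt_quot := exist _ _ (synt_reprK p).

Lemma synt_piP p q : synt_pi p = synt_pi q <-> synt p q.
Proof.
rewrite -eq_synt_repr; split=> [[]//|eq_pq]; exact: eq_exist.
Qed.

Lemma synt_valK (a : synt_quot) : synt_pi (sval a) = a.
Proof. by case: a => p pE; apply: eq_exist. Qed.

Definition synt_mul (a b : synt_quot) : synt_quot :=
  synt_pi (catw (sval a) (sval b)).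

Lemma synt_piM : {morph synt_pi : p q / catw p q >-> synt_mul p q}.
Proof. by move=> p q; apply: eq_exist; rewrite /= synt_repr_catw. Qed.

Lemma synt_mulA : associative synt_mul.
Proof.
by move=> a b c; rewrite -(synt_valK a) -(synt_valK b) -(synt_valK c) -!synt_piM catwA.
Qed.

Definition syntS : semigroup :=
  Semigroup synt_mulA (inhabits (synt_pi (letter 0))).

(** Evaluations in a quotient of the free semigroup lift to substitutions. *)
Lemma satisfies_syntS p q :
  satisfies syntS (p, q) <->
  forall g f h, X (plug g f h p) <-> X (plug g f h q).
Proof.
have eval_pi f w : eval (fun x => synt_pi (f x) : syntS) w = synt_pi (subst f w).
  by rewrite /subst (eval_hom (S := free) (S' := syntS) f w synt_piM).
split=> [Spq g f h|Xpq phi].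
  have := Spq (fun x => synt_pi (f x)); rewrite /= !eval_pi.
  by move/synt_piP; apply.
have -> : phi = fun x => synt_pi (sval (phi x)).
  by apply: funext => x; rewrite synt_valK.
by rewrite /= !eval_pi; apply/synt_piP => g h; apply: Xpq.
Qed.

End Syntactic.

(** * Identities of joins and meets of varieties *)
Definition holds (V : variety) (p q : word) : Prop :=
  forall S, class V S -> satisfies S (p, q).

Lemma holds_sym V p q : holds V p q -> holds V q p.
Proof. by move=> Vpq S /Vpq Spq phi; rewrite Spq. Qed.

Lemma holds_trans V q p r : holds V p q -> holds V q r -> holds V p r.
Proof. by move=> Vpq Vqr S VS phi; rewrite (Vpq S VS) (Vqr S VS). Qed.

Lemma holds_plug V g f h p q :
  holds V p q -> holds V (plug g f h p) (plug g f h q).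
Proof. by move=> Vpq S /Vpq; apply: satisfies_plug. Qed.

Lemma in_variety (V : variety) S :
  (forall p q, holds V p q -> satisfies S (p, q)) -> class V S.
Proof.
case: (classP V) => Sigma VE VS; rewrite VE => -[p q] pq.
by apply: VS => T; rewrite VE; apply.
Qed.

Lemma levP (V W : variety) : reflect (forall S, class V S -> class W S) (V <= W)%O.
Proof. exact: asboolP. Qed.

Lemma in_joinP (V W : variety) S :
  class (V `|` W)%O S <->
  forall p q, holds V p q -> holds W p q -> satisfies S (p, q).
Proof.
split=> [VWS p q Vpq Wpq|VWS].
  have pqvar : is_variety (models (eq (p, q))) by exists (eq (p, q)).
  suff : (V `|` W <= Variety pqvar)%O by move/levP/(_ S VWS); apply.
  by rewrite leUx; apply/andP; split; apply/levP => T TV _ <-;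
    [apply: Vpq|apply: Wpq].
apply: in_variety => p q pq; apply: VWS => T TV; apply: pq.
  by apply: (levP V (V `|` W)%O _) T TV; rewrite leUl.
by apply: (levP W (V `|` W)%O _) T TV; rewrite leUr.
Qed.

Lemma in_meetP (V W : variety) S : class (V `&` W)%O S <-> class V S /\ class W S.
Proof. by []. Qed.

(** The meet contains the syntactic semigroup of any language closed under the
    identities of both varieties: this is the induction principle for chains of
    deductions from the two sets of identities. *)
Lemma holds_meet (Y Z : variety) p q (X : word -> Prop) :
  (forall u v, holds Y u v -> X u -> X v) ->
  (forall u v, holds Z u v -> X u -> X v) ->
  holds (Y `&` Z)%O p q -> X p -> X q.
Proof.
move=> XY XZ pq Xp.
have mem V : (forall u v, holds V u v -> X u -> X v) -> class V (syntS X).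
  move=> XV; apply: in_variety => u v uv; apply/satisfies_syntS => g f h.
  by split; apply: XV; apply: holds_plug => //; apply: holds_sym.
have /satisfies_syntS/(_ [::] letter [::]) : satisfies (syntS X) (p, q).
  by apply: pq; split; apply: mem.
by rewrite !plug_id => -[+ _]; apply.
Qed.

(** * Joins of lower-modular varieties and 0-reduced varieties *)
Lemma exists_fresh (s : seq nat) : exists x, x \notin s.
Proof.
exists (\max_(y <- s) y).+1; apply/negP => /leq_bigmax_seq -/(_ xpredT id isT) /=.
by rewrite ltnn.
Qed.

(** The fully invariant ideal of the free semigroup generated by [W]. *)
Definition ideal (W : word -> Prop) (p : word) : Prop :=
  exists g f h, exists2 t, W t & p = plug g f h t.

Definition zero_variety (N : variety) (W : word -> Prop) : Prop :=
  class N = models (zero_identities W).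

Definition is_zero (S : semigroup) (z : S) : Prop :=
  forall a, mulS z a = z /\ mulS a z = z.

Lemma ideal_zero (N : variety) W (S : semigroup) (phi : nat -> S) p :
  zero_variety N W -> class N S -> ideal W p -> is_zero (eval phi p).
Proof.
move=> NE; rewrite NE => SN [g [f [h [t Wt ->]]]].
have z0 : is_zero (eval (eval phi \o f) t).
  set psi := _ \o f => a; have [x xt] := exists_fresh (letters t).
  pose psi' y := if y == x then a else psi y.
  have psi't : eval psi' t = eval psi t.
    apply: eq_eval => y yt; rewrite /psi'; case: eqP => // yx.
    by rewrite yx (negPf xt) in yt.
  have ax : eval psi' (letter x) = a by rewrite /eval /= /psi' eqxx.
  split.
    have /(_ psi') : satisfies S (catw t (letter x), t).
      by apply: SN; exists t, x; split=> //; left.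
    by rewrite /= eval_catw ax psi't.
  have /(_ psi') : satisfies S (catw (letter x) t, t).
    by apply: SN; exists t, x; split=> //; right.
  by rewrite /= eval_catw ax psi't.
suff -> : eval phi (plug g f h t) = eval (eval phi \o f) t by [].
move: (eval _ t) z0 (eval_subst phi f t) => z z0 zE.
apply: Some_inj; rewrite Some_eval letters_plug !big_cat /= -Some_eval zE.
case: (\big[_/_]_(x <- h) _) => [b|]; case: (\big[_/_]_(x <- g) _) => [a|] //=.
- by have [-> _] := z0 b; have [_ ->] := z0 a.
- by have [-> _] := z0 b.
- by have [_ ->] := z0 a.
Qed.

Lemma plug_catr g f h t x :
  plug g f h (catw t (letter x)) = plug g f (letters (f x) ++ h) t.
Proof.
apply: letters_inj; rewrite !letters_plug !letters_subst letters_catw.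
by rewrite letters_letter map_cat flatten_cat /= cats0 -!catA.
Qed.

Lemma plug_catl g f h t x :
  plug g f h (catw (letter x) t) = plug (g ++ letters (f x)) f h t.
Proof.
apply: letters_inj; rewrite !letters_plug !letters_subst letters_catw.
by rewrite letters_letter map_cat flatten_cat /= cats0 -!catA /= -!catA.
Qed.

(** Soundness is uniqueness of the zero; conversely the syntactic semigroup of
    a single word outside the ideal satisfies the zero identities, and it
    separates that word from all others. *)
Lemma zero_variety_holds (N : variety) W p q :
  zero_variety N W -> holds N p q <-> p = q \/ ideal W p /\ ideal W q.
Proof.
move=> NW; split=> [|[-> //|[Ip Iq] S SN phi]]; last first.
  have zp := ideal_zero phi NW SN Ip; have zq := ideal_zero phi NW SN Iq.
  by rewrite -(proj1 (zp (eval phi q))); have [_ ->] := zq (eval phi p).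
have outside u v : ~ ideal W u -> holds N u v -> v = u.
  move=> Iu uv; have NS : class N (syntS (eq u)).
    rewrite NW => _ [t [x [Wt _ [->|->]]]]; apply/satisfies_syntS => g f h.
      rewrite plug_catr; split=> uE; case: Iu; rewrite uE.
        by exists g, f, (letters (f x) ++ h), t.
      by exists g, f, h, t.
    rewrite plug_catl; split=> uE; case: Iu; rewrite uE.
      by exists (g ++ letters (f x)), f, h, t.
    by exists g, f, h, t.
  have /satisfies_syntS/(_ [::] letter [::]) := uv _ NS.
  by rewrite !plug_id => -[+ _] => /(_ erefl).
move=> pq; have [Ip|Ip] := pselect (ideal W p); last by left; rewrite (outside p q).
have [Iq|Iq] := pselect (ideal W q); first by right.
by left; rewrite (outside q p) //; apply: holds_sym.
Qed.

(** The opposite inclusion holds in every lattice. *)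
Lemma lower_modular_of_le (N : variety) :
  (forall Y Z : variety, (N <= Y)%O -> forall S,
     class Y S -> class (N `|` Z)%O S -> class (N `|` (Y `&` Z))%O S) ->
  lower_modular N.
Proof.
move=> Nlm Y Z NY; apply/le_anti/andP; split.
  by rewrite leUx !lexI NY leUl leIl /= leIxr // leUr.
by apply/levP => S /in_meetP [YS NZS]; apply: Nlm.
Qed.

Lemma zero_reduced_lower_modular (N : variety) :
  zero_reduced N -> lower_modular N.
Proof.
case=> W NW; apply: lower_modular_of_le => Y Z /levP NY S YS /in_joinP NZS.
have NWE p q := zero_variety_holds p q NW.
apply/in_joinP => u v Nuv YZuv.
have [->//|[Iu Iv]] := (NWE u v).1 Nuv.
pose eqS p q := satisfies S (p, q).
have eqS_trans p q r : eqS p q -> eqS q r -> eqS p r.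
  by move=> pq qr phi; rewrite pq qr.
have eqS_Z p q : ideal W p -> ideal W q -> holds Z p q -> eqS p q.
  by move=> Ip Iq Zpq; apply: NZS => //; apply/NWE; right.
(* A word outside the ideal is reached from u only by Z-steps out of the
   ideal, since the identities of Y do not move it. *)
pose X w := (ideal W w /\ eqS u w) \/
            (~ ideal W w /\ exists p, [/\ ideal W p, eqS u p & holds Z p w]).
have : X v.
  apply: (holds_meet (X := X) _ _ YZuv); last by left.
    move=> p q Ypq; have /NWE [<-//|[Ip Iq]] : holds N p q.
      by move=> T TN; apply: Ypq; apply: NY.
    case=> [[_ up]|[]//]; left; split=> //.
    by apply: eqS_trans up _; apply: Ypq.
  move=> p q Zpq Xp.
  have [r [Ir ur Zrq]] : exists r, [/\ ideal W r, eqS u r & holds Z r q].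
    case: Xp => [[Ip up]|[_ [r [Ir ur rp]]]]; first by exists p.
    by exists r; split=> //; apply: holds_trans rp Zpq.
  have [Iq|Iq] := pselect (ideal W q); last by right; split=> //; exists r.
  by left; split=> //; apply: eqS_trans ur _; apply: eqS_Z.
by case=> -[].
Qed.

(** Apply modularity of [x] with third element [a `|` z], then that of [a]. *)
Lemma joinv_lower_modular d (L : latticeType d) (x a : L) :
  lower_modular x -> lower_modular a -> lower_modular (x `|` a)%O.
Proof.
move=> xlm alm y z; rewrite leUx => /andP [xy ay].
by rewrite -!joinA alm // xlm.
Qed.

(** * The variety of semilattices is lower-modular *)
Lemma mem_subst f w y :
  reflect (exists2 x, x \in letters w & y \in letters (f x))
          (y \in letters (subst f w)).
Proof.
rewrite letters_subst; apply: (iffP flatten_mapP) => -[x]; by exists x.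
Qed.

Definition or_semigroup : semigroup := Semigroup orbA (inhabits false).

Lemma eval_or (phi : nat -> or_semigroup) w : eval phi w = has phi (letters w).
Proof.
case: w => x s; rewrite /eval /letters /=.
by elim: s (phi x) => [|y s IHs] b /=; rewrite ?orbF // IHs orbA.
Qed.

Lemma var_SL_holds p q : holds var_SL p q <-> letters p =i letters q.
Proof.
split=> [SLpq x|eq_pq].
  have SLor : class var_SL or_semigroup by split; [apply: orbC|apply: orbb].
  by have /= := SLpq _ SLor (pred1 x); rewrite !eval_or !has_pred1.
move=> S [mulC mulI] phi /=.
have absorb x w : x \in letters w -> mulS (phi x) (eval phi w) = eval phi w.
  move=> xw; apply: Some_inj; rewrite -[LHS]/(omul (Some _) (Some _)) Some_eval.
  elim: (letters w) xw => // y s IHs; rewrite inE big_cons.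
  case: eqP => [-> _|_ xs]; first by rewrite omulA /= mulI.
  have swap : omul (Some (phi x)) (Some (phi y)) = omul (Some (phi y)) (Some (phi x)).
    by rewrite /= mulC.
  by rewrite omulA swap -omulA IHs.
have absorb_eval u w : {subset letters u <= letters w} ->
    mulS (eval phi u) (eval phi w) = eval phi w.
  move=> uw; apply: Some_inj; rewrite -[LHS]/(omul (Some _) (Some _)) Some_eval.
  elim: (letters u) uw => [|x s IHs] xs_w; first by rewrite big_nil.
  rewrite big_cons -omulA IHs => [|y ys]; last by apply: xs_w; rewrite inE ys orbT.
  by rewrite /= absorb // xs_w ?mem_head.
rewrite -(absorb_eval q p) => [|x]; last by rewrite eq_pq.
by rewrite mulC absorb_eval // => x; rewrite eq_pq.
Qed.

Section Powers.
Variable S : semigroup.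
Implicit Types (a b e g : S).
Local Notation "a ** b" := (@omul S a b) (at level 40, left associativity).

Definition opow (a : option S) n : option S := iter n (omul a) None.

Lemma opowS (a : option S) n : opow a n.+1 = a ** opow a n. Proof. by []. Qed.

Lemma opowD (a : option S) m n : opow a (m + n) = opow a m ** opow a n.
Proof. by elim: m => //= m ->; rewrite omulA. Qed.

(** The value of a two-letter word, the letter 0 standing for [a] and all others
    for [b]. *)
Definition eval2 a b (s : seq nat) : option S :=
  \big[@omul S/None]_(i <- s) Some (if i == 0 then a else b).

Lemma eval2_pow a b j s : Some b = opow (Some a) j ->
  eval2 a b s = opow (Some a) (count_mem 0 s + j * count (predC1 0) s).
Proof.
move=> bE; elim: s => [|i s IHs] /=; first by rewrite /eval2 big_nil muln0.
rewrite /eval2 big_cons -/(eval2 a b s) IHs.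
by case: eqP => // _; rewrite add0n mulnDr muln1 addnCA [in RHS]opowD -bE.
Qed.

(** Inside the local monoid with unit [e], the letters 0 disappear. *)
Lemma eval2_local_unit e g s : mulS e e = e -> mulS e g = g -> mulS g e = g ->
  Some e ** eval2 e g s = Some e ** opow (Some g) (count (predC1 0) s).
Proof.
move=> ee eg ge; elim: s => [|i s IHs]; first by rewrite /eval2 big_nil.
rewrite /eval2 big_cons -/(eval2 e g s) omulA [count _ (_ :: _)]/=.
case: (i == 0); first by rewrite [_ ** Some e]/= ee.
have -> : Some e ** Some g = Some g ** Some e by rewrite /= eg ge.
by rewrite -omulA IHs opowS !omulA /= eg ge.
Qed.

End Powers.

Definition pair_subst (p d : word) (i : nat) : word := if i == 0 then p else d.

Lemma eval_pair_subst (S : semigroup) (phi : nat -> S) p d w :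
  Some (eval phi (subst (pair_subst p d) w)) =
  eval2 (eval phi p) (eval phi d) (letters w).
Proof.
rewrite eval_subst Some_eval /eval2; apply: eq_bigr => i _.
by rewrite /= /pair_subst; case: eqP.
Qed.

(** Let [Z] satisfy an identity between a two-letter word [Q], with first letter
    0 but not a power of it, and the power of length [N] of the letter 0.  With
    [m] occurrences of the other letter in [Q], the semigroups of [Z] satisfy
    x^(N+m) = x^N and their local monoids at idempotents are groups of exponent
    dividing [m]. *)
Section NoSemilattice.
Variables (Z : variety) (Q : word) (N : nat).
Let q := letters Q.
Hypothesis head_q : exists s, q = 0 :: s.
Hypothesis q1 : 1 \in q.
Hypothesis holds_Q : forall (S : semigroup) (a b : S), class Z S ->
  eval2 a b q = opow (Some a) N.

Let m := count (predC1 0) q.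

Lemma period_gt0 : 0 < m.
Proof. by rewrite -has_count; apply/hasP; exists 1. Qed.

Section InZ.
Variable S : semigroup.
Hypothesis ZS : class Z S.
Implicit Types (a b e g : S).
Local Notation "a ** b" := (@omul S a b) (at level 40, left associativity).

Lemma pow_period a j : opow (Some a) (N + j * m) = opow (Some a) N.
Proof.
(* Evaluating 1 at a, then at a^2, gives Q the exponents |Q| and |Q| + m. *)
have step : opow (Some a) (N + m) = opow (Some a) N.
  have aq := holds_Q a a ZS; have aaq := holds_Q a (mulS a a) ZS.
  rewrite opowD -{1}aq (@eval2_pow _ a a 1) // -opowD -aaq.
  by rewrite (@eval2_pow _ a _ 2) // mul1n mulSn mul1n addnA.
elim: j => [|j IHj]; first by rewrite addn0.
by rewrite mulSn addnA opowD step -opowD.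
Qed.

Lemma base_gt0 : 0 < N.
Proof.
have [x] := semigroup_nonempty S; have [s qE] := head_q.
have := holds_Q x x ZS; rewrite qE /eval2 big_cons /=.
by case: N => //=; case: (\big[_/_]_(_ <- _) _).
Qed.

Lemma exists_idem : exists e, mulS e e = e.
Proof.
have [a] := semigroup_nonempty S.
have idem : opow (Some a) (N * m) ** opow (Some a) (N * m) = opow (Some a) (N * m).
  have NmE : N * m = N + N * m.-1.
    by rewrite -mulnS prednK ?period_gt0.
  rewrite -opowD {1}NmE addnAC opowD pow_period -opowD.
  by rewrite -NmE.
have : 0 < N * m by rewrite muln_gt0 base_gt0 period_gt0.
case: (N * m) idem => // n; rewrite opowS.
by case: (opow _ n) => [b|] /= [ee] _; eexists; apply: ee.
Qed.

Lemma local_exponent e g : mulS e e = e -> mulS e g = g -> mulS g e = g ->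
  Some e ** opow (Some g) m = Some e.
Proof.
move=> ee eg ge; have [s qE] := head_q; rewrite -eval2_local_unit //.
have -> : Some e ** eval2 e g q = eval2 e g q.
  by rewrite qE /eval2 big_cons omulA /= ee.
rewrite holds_Q //; case: (N) base_gt0 => // n _.
by elim: n => // n IHn; rewrite opowS IHn /= ee.
Qed.

(** An element p = LR that factors through an idempotent e is a group element:
    p^(m+1) = L (RL)^m R, and RL lies in the local group at e. *)
Lemma pow_through_idem e (l r : option S) p j : mulS e e = e ->
  Some p = l ** Some e ** r -> opow (Some p) (j * m).+1 = Some p.
Proof.
move=> ee pE; pose L := l ** Some e; pose R := Some e ** r.
have eeE : Some e ** Some e = Some e by rewrite /= ee.
have {}pE : Some p = L ** R by rewrite pE /L /R !omulA -(omulA l (Some e) (Some e)) eeE.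
have [g gE] : exists g, R ** L = Some g.
  by rewrite /R /L; case: (r) => [r'|]; case: (l) => [l'|]; eexists.
have eg : mulS e g = g.
  by apply: Some_inj; rewrite -gE -[LHS]/(Some e ** Some g) -gE /R !omulA eeE.
have ge : mulS g e = g.
  by apply: Some_inj; rewrite -gE -[LHS]/(Some g ** Some e) -gE /L -!omulA eeE.
have shift n : opow (Some p) n ** L = L ** opow (Some g) n.
  elim: n => [|n IHn]; first by rewrite omul1x omulx1.
  by rewrite !opowS -omulA IHn pE -gE !omulA.
have LgL : L ** opow (Some g) m = L.
  have Le : L ** Some e = L by rewrite /L -omulA eeE.
  by rewrite -{1}Le -omulA local_exponent.
have step : opow (Some p) m.+1 = Some p.
  by rewrite -addn1 opowD [opow _ 1](_ : _ = L ** R) // omulA shift LgL.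
elim: j => [|j IHj]; first by rewrite mul0n.
by rewrite mulSn -addnS opowD IHj -[RHS]step -addn1 opowD.
Qed.

End InZ.

(** If a letter x occurs in only one of [p] and [p'], then [p = p'] shows that
    the common value of both sides does not depend on that of x, which may be
    chosen idempotent, so that [p] is a group element.  Then [Q(p, d)] equals
    [p^N], and the remaining power of [p] completes the exponent to [N m + 1]. *)
Lemma absorb_content (p p' d : word) :
  holds Z p p' -> ~ letters p =i letters p' ->
  holds Z p (subst (pair_subst p d) (rcat Q (nseq (N * m.-1).+1 0))).
Proof.
move=> Zpp' neq S ZS phi /=; apply: Some_inj.
rewrite eval_pair_subst letters_rcat /eval2 big_cat /= -!/(eval2 _ _ _).
rewrite holds_Q // [eval2 _ _ (_ :: _)](_ : _ = opow (Some (eval phi p)) (N * m.-1).+1).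
  rewrite -opowD addnS -mulnS prednK ?period_gt0 //.
  have [e ee] := exists_idem ZS.
  suff [l [r pE]] : exists l r, Some (eval phi p) = omul (omul l (Some e)) r.
    by rewrite (pow_through_idem ZS _ ee pE).
  have factor w x (psi : nat -> S) : x \in letters w -> psi x = e ->
      exists l r, Some (eval psi w) = omul (omul l (Some e)) r.
    rewrite Some_eval => /splitPr[s1 s2] psix.
    by rewrite big_cat /= big_cons psix omulA; do 2!eexists.
  have fresh w x : x \notin letters w ->
      eval (fun y => if y == x then e else phi y) w = eval phi w.
    by move=> xw; apply: eq_eval => y yw; case: eqP => // yx; rewrite -yx yw in xw.
  have /existsNP[x /eqP xpp'] : ~ forall x, (x \in letters p) = (x \in letters p').
    exact: neq.
  pose psi y := if y == x then e else phi y.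
  have psix : psi x = e by rewrite /psi eqxx.
  have Zphi := Zpp' S ZS phi; have Zpsi := Zpp' S ZS psi.
  have [xp|xp] := boolP (x \in letters p).
    have xp' : x \notin letters p' by move: xpp'; rewrite xp; case: (x \in _).
    by rewrite [eval phi p]Zphi -(fresh _ _ xp') -[eval _ _]Zpsi; apply: factor xp psix.
  have xp' : x \in letters p' by move: xpp'; rewrite (negPf xp); case: (x \in _).
  by rewrite -(fresh _ _ xp) [eval _ _]Zpsi; apply: factor xp' psix.
by rewrite -[_ :: _]/(nseq _.+1 0) /eval2 big_nseq.
Qed.

End NoSemilattice.

Lemma content_witness V p q : holds V p q -> ~ letters p =i letters q ->
  exists p' q' x, [/\ holds V p' q', x \in letters p' & x \notin letters q'].
Proof.
move=> Vpq /existsNP[x /eqP]; have [xp|xp] := boolP (x \in letters p).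
  by case: (boolP (x \in letters q)) => // xq _; exists p, q, x.
case: (boolP (x \in letters q)) => // xq _; exists q, p, x.
by split=> //; apply: holds_sym.
Qed.

Lemma exists_absorbing_word (Z : variety) p0 q0 :
  holds Z p0 q0 -> ~ letters p0 =i letters q0 ->
  exists E, [/\ 0 \in letters E, 1 \in letters E &
    forall p p' d, holds Z p p' -> ~ letters p =i letters p' ->
      holds Z p (subst (pair_subst p d) E)].
Proof.
move=> Zpq0 neq; have [{Zpq0 neq}p0 [{}q0 [x [Zpq xp xq]]]] := content_witness Zpq0 neq.
(* Merge all letters but x; the leading 0 makes both letters occur. *)
pose f y := letter (y == x).
pose Q := plug [:: 0] f [::] p0; pose N := size (letters (plug [:: 0] f [::] q0)).
have Q1 : 1 \in letters Q.
  rewrite letters_plug cats0 mem_cat; apply/orP; right.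
  by apply/mem_subst; exists x => //; rewrite /f eqxx letters_letter mem_head.
have Q0 : exists s, letters Q = 0 :: s by rewrite letters_plug; eexists.
have qE : letters (plug [:: 0] f [::] q0) = nseq N 0.
  apply/all_pred1P/allP => y /=; have [-> //|y0] := eqVneq y 0.
  rewrite letters_plug cats0 mem_cat inE (negPf y0) => /mem_subst[z zq].
  rewrite /f letters_letter inE => /eqP yz; case: eqP yz zq => [->|_ yz].
    by rewrite (negPf xq).
  by rewrite yz in y0.
have QN (S : semigroup) (a b : S) : class Z S -> eval2 a b (letters Q) = opow (Some a) N.
  move=> ZS; pose phi i := if i == 0 then a else b.
  have Qphi : eval phi Q = eval phi (plug [:: 0] f [::] q0).
    exact: (holds_plug [:: 0] f [::] Zpq ZS phi).
  by have := congr1 (@Some S) Qphi; rewrite !Some_eval qE big_nseq.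
eexists; split; last by move=> p p' d; apply: (absorb_content Q0 Q1 QN).
  by have [s QE] := Q0; rewrite letters_rcat QE mem_head.
by rewrite letters_rcat mem_cat Q1.
Qed.

Lemma semilattice_lower_modular : lower_modular var_SL.
Proof.
apply: lower_modular_of_le => Y Z /levP SLY S YS /in_joinP SLZS.
pose eqS p q := satisfies S (p, q).
have eqS_trans p q r : eqS p q -> eqS q r -> eqS p r.
  by move=> pq qr phi; rewrite pq qr.
have eqS_sym p q : eqS p q -> eqS q p by move=> pq phi; rewrite pq.
have eqS_Z p q : letters p =i letters q -> holds Z p q -> eqS p q.
  by move=> pq; apply: SLZS; apply/var_SL_holds.
have Y_content p q : holds Y p q -> letters p =i letters q.
  by move=> Ypq; apply/var_SL_holds => T /SLY; apply: Ypq.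
apply/in_joinP => u v /var_SL_holds uv YZuv.
have [Zcontent|] := pselect (forall p q, holds Z p q -> letters p =i letters q).
  apply: YZuv; split=> //; apply: in_variety => p q Zpq.
  by apply: eqS_Z => //; apply: Zcontent.
move=> /existsNP[p0] /existsNP[q0] /not_implyP[Zpq0 neq0].
have [E [E0 E1 ZE]] := exists_absorbing_word Zpq0 neq0.
(* F repairs the content of the words of a chain whose letters are in u; the
   retraction onto the letters of u, which fixes u and v, reduces to such
   chains. *)
pose F w := subst (pair_subst w u) E.
have eqS_F p q : eqS p q -> eqS (F p) (F q).
  move=> pq phi; apply: Some_inj; rewrite /= !eval_pair_subst.
  by rewrite [eval phi p]pq.
pose psi y := if y \in letters u then letter y else letter u.1.
pose ret w := subst psi w.
have ret_sub w : {subset letters (ret w) <= letters u}.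
  move=> y /mem_subst[x _]; rewrite /psi; case: ifP => xu.
    by rewrite letters_letter inE => /eqP ->.
  by rewrite letters_letter inE => /eqP ->; rewrite /letters mem_head.
have F_content w : {subset letters w <= letters u} -> letters (F w) =i letters u.
  move=> wu y; apply/mem_subst/idP => [[x _]|yu]; last by exists 1.
  by rewrite /pair_subst; case: eqP => // _ /wu.
have ret_id w : letters w =i letters u -> ret w = w.
  move=> wu; apply: letters_inj; rewrite letters_subst -[RHS]flatten_seq1.
  congr flatten; apply/eq_in_map => y; rewrite wu /psi => ->.
  by rewrite letters_letter.
have ret_holds V p q : holds V p q -> holds V (ret p) (ret q).
  by move=> /(holds_plug [::] psi [::]); rewrite !plug_subst.
pose full w := letters w =i letters u.
pose X w := full (ret w) /\ eqS u (ret w) \/ ~ full (ret w) /\ eqS u (F (ret w)).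
have : X v.
  apply: (holds_meet (X := X) _ _ YZuv); last by left; split; rewrite ret_id.
    move=> p q /ret_holds; rewrite /X.
    move: (ret p) (ret q) => {}p {}q Ypq; have pq := Y_content _ _ Ypq.
    have Spq : eqS p q by apply: Ypq.
    have full_pq : full p <-> full q by split=> ful y; rewrite -ful pq.
    case=> -[fp up]; [left|right]; split; rewrite -?full_pq //.
      exact: eqS_trans up Spq.
    by apply: eqS_trans up _; apply: eqS_F.
  move=> p q Zpq0'; have Zpq := ret_holds _ _ _ Zpq0'; rewrite /X.
  have [pu qu] := (ret_sub p, ret_sub q).
  move: (ret p) (ret q) pu qu Zpq => {Zpq0'}p {}q pu qu Zpq.
  have Spq_full : full p -> full q -> eqS p q.
    by move=> fp fq; apply: eqS_Z => // y; rewrite fp fq.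
  have SF : eqS (F p) (F q).
    apply: eqS_Z => [y|]; first by rewrite !F_content.
    move=> T ZT phi; apply: Some_inj; rewrite /= !eval_pair_subst.
    by rewrite [eval phi p](Zpq T ZT).
  have SFself w w' : holds Z w w' -> full w -> ~ full w' -> eqS w (F w).
    move=> Zw fw fw'; apply: eqS_Z => [y|]; first by rewrite F_content // => z; rewrite fw.
    by apply: ZE Zw _ => ww'; apply: fw' => y; rewrite -ww' fw.
  (* When a Z-step changes whether the content is full, its full side w is the
   side of an identity of Z with unequal contents, hence w = F w in S. *)
have [fq|fq] := pselect (full q); case=> -[fp up]; [left|left|right|right]; split=> //.
  - by apply: eqS_trans up _; apply: Spq_full.
  - apply: eqS_trans up (eqS_trans _ _ _ SF (eqS_sym _ _ _)).
    exact: SFself (holds_sym Zpq) fq fp.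
  - exact: eqS_trans up (eqS_trans _ _ _ (SFself _ _ Zpq fp fq) SF).
  - exact: eqS_trans up SF.
have vu : full v by move=> y; rewrite uv.
by rewrite /X ret_id // => -[[]|[]].
Qed.

(** * The consequence of lower-modularity *)
Record fi_congruence (R : word -> word -> Prop) : Prop := {
  fi_refl : forall p, R p p;
  fi_sym : forall p q, R p q -> R q p;
  fi_trans : forall q p r, R p q -> R q r -> R p r;
  fi_plug : forall g f h p q, R p q -> R (plug g f h p) (plug g f h q) }.

Lemma fi_satisfies (S : semigroup) : fi_congruence (fun p q => satisfies S (p, q)).
Proof.
split=> [//|p q pq phi|q p r pq qr phi|]; first by rewrite /= [eval phi p]pq.
  by rewrite /= [eval phi p]pq.
by move=> g f h p q; apply: satisfies_plug.
Qed.

(** Take for [Y] the variety with all identities of [V] that hold in the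
    syntactic semigroup [S] of the single word [u], and for [Z] the variety of
    [R].  If no other word were related to [u] both by [R] and in [V], then [S]
    would belong to [V `|` Z], hence to [V `|` (Y `&` Z)] by modularity; but
    the latter satisfies [u = v], through u, u', v', v. *)
Lemma isolated_step (V : variety) (R : word -> word -> Prop) u u' v' v :
  lower_modular V -> fi_congruence R ->
  holds V u v -> u <> v -> R u u' -> holds V u' v' -> R v' v ->
  (forall g f h, u <> plug g f h u') -> (forall g f h, u <> plug g f h v') ->
  exists w, [/\ w <> u, holds V u w & R u w].
Proof.
move=> Vlm [Rrefl Rsym Rtrans Rplug] Vuv neq_uv uu' Vuv' v'v uNu' uNv'.
apply: contrapT => noW.
have fixed w : holds V u w -> R u w -> w = u.
  by move=> Vuw Ruw; apply: contrapT => wu; apply: noW; exists w.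
pose S := syntS (eq u).
have Yvar : is_variety (models (fun e => holds V e.1 e.2 /\ satisfies S e)) by eexists.
have Zvar : is_variety (models (fun e => R e.1 e.2)) by eexists.
pose Y := Variety Yvar; pose Z := Variety Zvar.
have Z_holds p q : holds Z p q -> R p q.
  have ZS : class Z (syntS (R p)).
    move=> [a b] Rab; apply/satisfies_syntS => g f h.
    split=> pR; apply: Rtrans pR _; apply: Rplug => //; exact: Rsym.
  move=> /(_ _ ZS)/satisfies_syntS/(_ [::] letter [::]).
  by rewrite !plug_id => -[+ _]; apply.
have VY : (V <= Y)%O by apply/levP => T VT [p q] [Vpq _]; apply: Vpq.
have SY : class Y S by move=> e [].
have SVZ : class (V `|` Z)%O S.
  have half p q g f h : holds V p q -> holds Z p q ->
      u = plug g f h p -> u = plug g f h q.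
    move=> Vpq Zpq uE; symmetry; apply: fixed.
      by rewrite {1}uE; apply: holds_plug.
    by rewrite {1}uE; apply: Rplug; apply: Z_holds.
  apply/in_joinP => p q Vpq Zpq; apply/satisfies_syntS => g f h.
  by split; apply: half => //; apply: holds_sym.
have : class (V `|` (Y `&` Z))%O S by rewrite Vlm //; split.
move=> /in_joinP/(_ u v Vuv) uvS.
have /satisfies_syntS/(_ [::] letter [::]) : satisfies S (u, v).
  apply: uvS => T [TY TZ] phi /=.
  have -> : eval phi u = eval phi u' by apply: (TZ (u, u')).
  have <- : eval phi v' = eval phi v by apply: (TZ (v', v)).
  apply: (TY (u', v')); split=> //; apply/satisfies_syntS => g f h.
  by split=> uE; [case: (uNu' g f h)|case: (uNv' g f h)].
by rewrite !plug_id => -[/(_ erefl) uv _].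
Qed.

(** * Long words in nontrivial classes *)
Definition moved (V : variety) (u : word) : Prop :=
  exists2 v, v <> u & holds V u v.

(** Distinct words of length at most [K] are separated by a finite group of
    permutations of points (counter, bit): every letter increments the cyclic
    counter, and one chosen letter at one chosen position flips the bit. *)
Section Mates.
Variable K : nat.
Local Notation point := ('I_K.+1 * bool)%type.

Definition toggle (i a x : nat) (pt : point) : point :=
  (ordS pt.1, pt.2 (+) ((val pt.1 == i) && (x == a))).

Lemma toggle_inj i a x : injective (toggle i a x).
Proof.
move=> [j b] [k c] eq_jk; have /ordS_inj /= jk := congr1 fst eq_jk.
by move: (congr1 snd eq_jk); rewrite /= jk => /addIb ->.
Qed.

Definition letter_perm i a x : {perm point} := perm (@toggle_inj i a x).

Definition perm_eval (phi : nat -> {perm point}) (s : seq nat) : {perm point} :=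
  (\prod_(x <- s) phi x)%g.

Lemma perm_eval_toggle i a s (j : 'I_K.+1) b : j + size s <= K ->
  perm_eval (letter_perm i a) s (j, b) =
  (inord (j + size s), b (+) [&& j <= i, i < j + size s & nth 0 s (i - j) == a]).
Proof.
rewrite /perm_eval; elim: s j b => [|x s IHs] j b /=.
  by rewrite big_nil perm1 addn0 inord_val ltnNge; case: (j <= i); rewrite addbF.
rewrite addnS => jsK; rewrite big_cons permM permE /toggle /=.
have jK : j.+1 < K.+1 by rewrite ltnS (leq_trans _ jsK) // ltnS leq_addr.
have vS : val (ordS j) = j.+1 by rewrite /= modn_small.
rewrite IHs vS ?addSn //; congr (_, _); rewrite -addbA; congr addb.
have [ij|ij|->] := ltngtP i j.
- by [].
- by rewrite -(subnSK ij).
by rewrite subnn ltnS leq_addr addbF.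
Qed.

Lemma perm_eval_separates s t : size s <= K -> size t <= K ->
  (forall phi, perm_eval phi s = perm_eval phi t) -> s = t.
Proof.
move=> sK tK st.
have run i a := congr1 (fun p : {perm point} => p (ord0, false)) (st (letter_perm i a)).
have size_st : size s = size t.
  have := run 0 0; rewrite !perm_eval_toggle ?add0n // => -[eq_st _].
  by have /= := congr1 val eq_st; rewrite !inordK.
apply: (@eq_from_nth _ 0) => // i i_s.
have := run i (nth 0 t i); rewrite !perm_eval_toggle ?add0n // => -[_].
by rewrite subn0 -size_st i_s eqxx => /eqP.
Qed.

Definition perm_content (p q : word) : Prop :=
  (forall phi, perm_eval phi (letters p) = perm_eval phi (letters q)) /\
  letters p =i letters q.

Lemma perm_content_fi : fi_congruence perm_content.
Proof.
split=> [//|p q [pq1 pq2]|q p r [pq1 pq2] [qr1 qr2]|g f h p q [pq1 pq2]].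
- by split=> x; rewrite ?pq1 ?pq2.
- by split=> x; rewrite ?pq1 ?qr1 ?pq2.
split=> [phi|x].
  have plugE w : perm_eval phi (letters (plug g f h w)) = (perm_eval phi g *
      (perm_eval (fun x => perm_eval phi (letters (f x))) (letters w) *
       perm_eval phi h))%g.
    have <- : perm_eval phi (letters (subst f w)) =
              perm_eval (fun x => perm_eval phi (letters (f x))) (letters w).
      by rewrite /perm_eval letters_subst big_flatten big_map.
    by rewrite /perm_eval letters_plug !big_cat.
  by rewrite !plugE pq1.
rewrite !letters_plug !mem_cat; congr (_ || (_ || _)).
by apply/mem_subst/mem_subst => -[y]; rewrite ?pq2 => yp; exists y; rewrite ?pq2.
Qed.

End Mates.

(** Exponents start at 1: [wpow u n] is u^(n+1). *)
Definition wpow (u : word) (n : nat) : word := iter n (catw u) u.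

Lemma size_wpow u n : size (letters (wpow u n)) = n.+1 * size (letters u).
Proof.
elim: n => [|n IHn]; first by rewrite mul1n.
by rewrite [wpow _ _]/= letters_catw size_cat IHn -mulSn.
Qed.

(** The exponent is 1 modulo the order of the group. *)
Lemma perm_content_wpow K u c :
  perm_content K u (wpow u (#|[set: {perm 'I_K.+1 * bool}]| * c)).
Proof.
split=> [phi|x].
  have powE n : perm_eval phi (letters (wpow u n)) = (perm_eval phi (letters u) ^+ n.+1)%g.
    elim: n => [|n IHn]; first by rewrite expg1.
    by rewrite [wpow _ _]/= letters_catw /perm_eval big_cat /= [X in (_ * X)%g]IHn -expgS.
  rewrite powE expgS expgnA; set a := perm_eval _ _.
  have /dvdnP[d ->] : #[a]%g %| #|[set: {perm 'I_K.+1 * bool}]| by rewrite cardSg ?subsetT.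
  by rewrite mulnC expgnA expg_order !expg1n mulg1.
elim: (_ * c) => // n IHn.
by rewrite [wpow _ _]/= letters_catw mem_cat -IHn orbb.
Qed.

(** * Words of equal length and renamings of letters *)

Lemma size_letters_gt0 u : 0 < size (letters u).
Proof. by []. Qed.

(** A substitution that does not lengthen a word maps its letters to letters. *)
Lemma size_subst_eq (f : nat -> word) (s : seq nat) :
  size (flatten [seq letters (f x) | x <- s]) <= size s ->
  {in s, forall x, letters (f x) = [:: (f x).1]}.
Proof.
have ge t : size t <= size (flatten [seq letters (f x) | x <- t]).
  by elim: t => //= y t IHt; rewrite ltnS size_cat (leq_trans IHt) ?leq_addl.
elim: s => //= x s IHs le_s.
have {}le_s : size (f x).2 + size (flatten [seq letters (f x) | x <- s]) <= size s.
  by move: le_s; rewrite size_cat.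
have f0 : (f x).2 = [::].
  apply/nilP; rewrite /nilp -leqn0 -(leq_add2r (size s)).
  by rewrite (leq_trans _ le_s) // leq_add2l ge.
move=> y; rewrite inE => /orP[/eqP ->|]; first by rewrite /letters f0.
by apply: IHs; rewrite f0 in le_s.
Qed.

Lemma plug_same_size g f h p q : size (letters p) = size (letters q) ->
  plug g f h p = q ->
  exists phi : nat -> nat, map phi (letters p) = letters q /\
    forall w, {subset letters w <= letters p} ->
      letters (plug g f h w) = map phi (letters w).
Proof.
move=> eq_pq plugE; have : size (letters (plug g f h p)) <= size (letters p).
  by rewrite plugE eq_pq.
rewrite letters_plug !size_cat => le_p.
have le_sub := size_subst f p.
have [g0 h0] : g = [::] /\ h = [::].
  have : size g + size h + size (letters p) <= size (letters p).
    by rewrite (leq_trans _ le_p) // addnAC -addnA leq_add2l leq_add2r.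
  by rewrite -[X in _ <= X]add0n leq_add2r leqn0 addn_eq0 => /andP[/nilP -> /nilP ->].
move: le_p plugE; rewrite {}g0 {}h0 addn0 letters_subst => /size_subst_eq fE plugE.
exists (fun x => (f x).1).
have phiE w : {subset letters w <= letters p} ->
    letters (plug [::] f [::] w) = [seq (f x).1 | x <- letters w].
  move=> wp; rewrite letters_plug cats0 letters_subst -[RHS]flatten_seq1 -map_comp.
  by congr flatten; apply/eq_in_map => x /wp /fE.
by split=> //; rewrite -phiE // plugE.
Qed.

Definition renames (p q : word) : Prop :=
  exists phi : nat -> nat, map phi (letters p) = letters q.

Lemma uniq_map_inj (phi : nat -> nat) (s : seq nat) :
  uniq (map phi s) -> {in s &, injective phi}.
Proof.
elim: s => //= z s IHs /andP[phi_z s_uniq] x y.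
rewrite !inE => /orP[/eqP->|xs] /orP[/eqP->|ys] eq_xy //; last exact: IHs.
  by rewrite eq_xy map_f in phi_z.
by rewrite -eq_xy map_f in phi_z.
Qed.

(** As the contents are equal, the renaming permutes them. *)
Lemma renames_sym p q : letters p =i letters q -> renames p q -> renames q p.
Proof.
move=> pq [phi pE]; have phi_inj : {in letters p &, injective phi}.
  have perm_pq : perm_eq (undup (letters p)) (undup (letters q)).
    by apply: uniq_perm; rewrite ?undup_uniq // => x; rewrite !mem_undup pq.
  have /uniq_map_inj phi_inj : uniq (map phi (undup (letters p))).
    apply: (leq_size_uniq (undup_uniq (letters q))) => [y|].
      rewrite mem_undup -pE => /mapP[x xp ->].
      by rewrite map_f // mem_undup.
    by rewrite size_map (perm_size perm_pq).
  by move=> x y xp yp; apply: phi_inj; rewrite mem_undup.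
exists (fun y => nth 0 (letters p) (index y (letters q))).
rewrite -pE -map_comp -[RHS]map_id; apply/eq_in_map => x xp /=.
have i_p : index (phi x) (map phi (letters p)) < size (letters p).
  by rewrite -(size_map phi) index_mem map_f.
apply: phi_inj => //; first exact: mem_nth.
by rewrite -(nth_map 0 0) // nth_index // map_f.
Qed.

Lemma map_prefix (phi : nat -> nat) (s q q' : seq nat) :
  map phi (s ++ q) = s ++ q' -> {in s, phi =1 id} /\ map phi q = q'.
Proof.
rewrite map_cat => /eqP; rewrite eqseq_cat ?size_map // => /andP[/eqP sE /eqP ->].
by split=> //; apply/eq_in_map; rewrite map_id.
Qed.

Lemma rcat_plug t q : rcat t q = plug [::] letter q t.
Proof. by rewrite /plug subst_id. Qed.

(** * Words in nontrivial classes with the same content *)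
Section Necessity.
Variable V : variety.
Hypothesis Vlm : lower_modular V.

(** [isolated_step] for the identities of equal content of a finite group that
    separates the words of length at most K: the word w that it provides is
    distinct from u, hence is long. *)
Lemma long_mate u K : moved V u ->
  exists w, [/\ holds V u w, letters w =i letters u & K < size (letters w)].
Proof.
case=> v vu Vuv; set n := size (letters u); pose K' := maxn K n.
pose k := #|[set: {perm 'I_K'.+1 * bool}]| * n.
have k_ge : n <= k by rewrite leq_pmull ?cardG_gt0.
have big x : n < size (letters (wpow x k)).
  by rewrite size_wpow (leq_trans _ (leq_pmulr _ (size_letters_gt0 x))).
have out x g f h : u <> plug g f h (wpow x k).
  move=> uE; have := leq_trans (big x) (size_plug g f h (wpow x k)).
  by rewrite -uE ltnn.
have congR := perm_content_fi K'.
have Vpow : holds V (wpow u k) (wpow v k).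
  move=> S VS phi /=; rewrite /wpow.
  by elim: (k) => [|j IHj] /=; rewrite ?eval_catw ?IHj [eval phi u](Vuv S VS).
have [w [wu Vuw [uw1 uw2]]] := isolated_step Vlm congR Vuv (nesym vu)
  (perm_content_wpow K' u n) Vpow (fi_sym congR (perm_content_wpow K' v n))
  (out u) (out v).
exists w; split=> //; rewrite ltnNge; apply/negP => wK; apply: wu; apply: letters_inj.
symmetry; apply: (perm_eval_separates (K := K')) uw1; first exact: leq_maxr.
by rewrite (leq_trans wK) ?leq_maxl.
Qed.

Lemma moved_plug g f h t : moved V t -> moved V (plug g f h t).
Proof.
move=> /(long_mate (size (letters (plug g f h t)))) [w [Vtw _ wt]].
exists (plug g f h w); last exact: holds_plug.
move=> eq_wt; have := leq_trans wt (size_plug g f h w).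
by rewrite eq_wt ltnn.
Qed.

(** [isolated_step] for the identities of the syntactic semigroup of the set
    of [s] and [t], along s, t, t', s' where [s'] and [t'] are longer words
    given by [long_mate].  The identity [(s, t)] holds there: a consequence of it
    that involves [s] or [t] is [(s, t)] itself, because these words have equal
    lengths and contents and are not renamings of each other. *)
Lemma moved_same_size s t : moved V s -> moved V t ->
  size (letters s) = size (letters t) -> letters s =i letters t ->
  ~ renames s t -> ~ renames t s -> holds V s t.
Proof.
move=> Ms Mt st eq_st ren_st ren_ts.
have [s' [Vss' _ s's]] := long_mate (size (letters s)) Ms.
have [t' [Vtt' _ t't]] := long_mate (size (letters s)) Mt.
have long w g f h u : size (letters s) < size (letters w) ->
    size (letters u) = size (letters s) -> plug g f h w <> u.
  move=> sw us uE; have := leq_trans sw (size_plug g f h w).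
  by rewrite uE us ltnn.
pose X w := w = s \/ w = t.
have fix_id p q g f h : letters p =i letters q -> plug g f h p = p -> plug g f h q = q.
  move=> pq /(plug_same_size erefl) [phi [pE plugE]]; apply: letters_inj.
  rewrite plugE; last by move=> x; rewrite pq.
  rewrite -[RHS]map_id; apply/eq_in_map => x; rewrite -pq.
  by move: x; apply/eq_in_map; rewrite map_id.
have [w [ws Vsw]] : exists w, [/\ w <> s, holds V s w & satisfies (syntS X) (s, w)].
  apply: (isolated_step (u' := t) (v' := t') Vlm (fi_satisfies _) Vss') => //.
  - by move=> eq_ss'; move: s's; rewrite -eq_ss' ltnn.
  - apply/satisfies_syntS => g f h; split=> -[].
    + by move/(fix_id _ t) => ->; [right|].
    + by case/(plug_same_size st) => phi [? _]; case: ren_st; exists phi.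
    + by case/(plug_same_size (esym st)) => phi [? _]; case: ren_ts; exists phi.
    by move/(fix_id _ s) => ->; [left|move=> x; rewrite eq_st].
  - apply/satisfies_syntS => g f h.
    by split=> -[]/long; case.
  - move=> g f h /esym/(plug_same_size (esym st))[phi [? _]].
    by case: ren_ts; exists phi.
  by move=> g f h /esym; apply: long.
move=> /satisfies_syntS/(_ [::] letter [::]); rewrite !plug_id => -[+ _].
by case=> [|//|wt]; [left|rewrite -wt].
Qed.

Lemma moved_extensions t q q' : moved V t -> size q = size q' ->
  {subset q <= letters t} -> {subset q' <= letters t} ->
  holds V (rcat t q) (rcat t q').
Proof.
move=> Mt qq' qt q't; have [<-//|neq] := eqVneq q q'.
have content r : {subset r <= letters t} -> letters (rcat t r) =i letters t.
  by move=> rt x; rewrite letters_rcat mem_cat; apply: orb_idr; apply: rt.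
have no_ren r r' : {subset r <= letters t} -> renames (rcat t r) (rcat t r') -> r = r'.
  move=> rt [phi]; rewrite !letters_rcat => /map_prefix[phi_t <-].
  by rewrite -[LHS]map_id; apply/eq_in_map => x /rt /phi_t.
apply: moved_same_size.
- by rewrite rcat_plug; apply: moved_plug.
- by rewrite rcat_plug; apply: moved_plug.
- by rewrite !letters_rcat !size_cat qq'.
- by move=> x; rewrite !content.
- by move/no_ren => /(_ qt)/eqP; apply/negP.
by move/no_ren => /(_ q't)/esym/eqP; apply/negP.
Qed.

(** For distinct letters x and y outside t, the words txyy and txxy are not
    renamings of each other.  Substituting zz for x and z for y turns equal
    lengths into consecutive ones. *)
Lemma moved_power_step t z : moved V t ->
  holds V (rcat t (nseq 4 z)) (rcat t (nseq 5 z)).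
Proof.
move=> Mt; have [x xt] := exists_fresh (letters t).
have [y] := exists_fresh (x :: letters t); rewrite inE negb_or => /andP[yx yt].
have Vxy : holds V (rcat t [:: x; y; y]) (rcat t [:: x; x; y]).
  apply: moved_same_size.
  - by rewrite rcat_plug; apply: moved_plug.
  - by rewrite rcat_plug; apply: moved_plug.
  - by rewrite !letters_rcat !size_cat.
  - move=> w; rewrite !letters_rcat !mem_cat !inE.
    by case: (w == x); case: (w == y); rewrite ?orbT.
  - case=> phi; rewrite !letters_rcat => /map_prefix[_ [_ -> xy]].
    by rewrite xy eqxx in yx.
  case=> phi; rewrite !letters_rcat => /map_prefix[_ [-> xy _]].
  by rewrite xy eqxx in yx.
pose f w := if w == x then catw (letter z) (letter z) else
            if w == y then letter z else letter w.
have fE q : plug [::] f [::] (rcat t q) = rcat t (flatten [seq letters (f w) | w <- q]).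
  apply: letters_inj; rewrite letters_plug cats0 letters_subst !letters_rcat map_cat.
  rewrite flatten_cat; suff -> : [seq letters (f w) | w <- letters t] =
                                 [seq [:: w] | w <- letters t] by rewrite flatten_seq1.
  apply/eq_in_map => w wt; rewrite /f.
  case: eqP => [wx|_]; first by rewrite -wx wt in xt.
  by case: eqP => [wy|_] //; rewrite -wy wt in yt.
have := holds_plug [::] f [::] Vxy; rewrite !fE /= /f eqxx (negPf yx).
by rewrite eqxx.
Qed.

Lemma moved_power t z i : moved V t ->
  holds V (rcat t (nseq 4 z)) (rcat t (nseq (4 + i) z)).
Proof.
move=> Mt; elim: i => [//|i IHi]; apply: holds_trans IHi _.
have nseqE n : rcat t (nseq (n + i) z) = plug [::] letter (nseq i z) (rcat t (nseq n z)).
  by rewrite -rcat_plug; apply: letters_inj; rewrite !letters_rcat -catA -nseqD.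
by rewrite -addSnnS !nseqE; apply: holds_plug; apply: moved_power_step.
Qed.

Lemma moved_mate s s' : moved V s -> holds V s s' -> moved V s'.
Proof.
move=> /(long_mate (size (letters s'))) [w [Vsw _ ws]] Vss'; exists w.
  by move=> eq_ws; rewrite eq_ws ltnn in ws.
exact: holds_trans (holds_sym Vss') Vsw.
Qed.

(** A long mate [s'] of [s] is compared with the extensions of [t] by powers of a
    letter of [t]: it is a renaming of at most one of them, unless [t] has a
    single letter and [s'] is itself that extension. *)
Lemma moved_to_power s t : moved V s -> moved V t -> letters s =i letters t ->
  exists2 y, y \in letters t & holds V s (rcat t (nseq 4 y)).
Proof.
move=> Ms Mt st; have [s' [Vss' s's s't]] := long_mate (size (letters t) + 3) Ms.
have [d s'E] : exists d, size (letters s') = size (letters t) + (4 + d).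
  exists (size (letters s') - (size (letters t) + 4)).
  by rewrite addnA subnKC // addnS.
suff [y yt Vs'y] : exists2 y, y \in letters t & holds V s' (rcat t (nseq (4 + d) y)).
  exists y => //; apply: holds_trans Vss' (holds_trans Vs'y _).
  by apply: holds_sym; apply: moved_power.
have content y : y \in letters t -> letters (rcat t (nseq (4 + d) y)) =i letters s'.
  move=> yt x; rewrite letters_rcat mem_cat s's st mem_nseq /=.
  by apply: orb_idr => /eqP ->.
have Ms' := moved_mate Ms Vss'.
have connect y : y \in letters t -> ~ renames (rcat t (nseq (4 + d) y)) s' ->
    holds V s' (rcat t (nseq (4 + d) y)).
  move=> yt ren; apply: moved_same_size => //.
  - by rewrite rcat_plug; apply: moved_plug.
  - by rewrite letters_rcat size_cat size_nseq.
  - by move=> x; rewrite content.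
  by move/renames_sym => ren'; apply: ren; apply: ren' => x; rewrite content.
pose x := t.1; have xt : x \in letters t by rewrite mem_head.
have [ren_x|] := pselect (renames (rcat t (nseq (4 + d) x)) s'); last first.
  by exists x => //; apply: connect.
have [/hasP[y yt yx]|/hasPn all_x] := boolP (has (predC1 x) (letters t)).
  exists y => //; apply: connect => // ren_y.
  have [phi phiE] := renames_sym (content y yt) ren_y; have [psi psiE] := ren_x.
  move: phiE; rewrite -psiE -map_comp !letters_rcat => /map_prefix[/(_ x xt) /= -> [xy _]].
  by rewrite xy /= eqxx in yx.
have s'x : all (pred1 x) (letters s').
  by apply/allP => y; rewrite s's st => /all_x; rewrite negbK.
have tx : all (pred1 x) (letters t) by apply/allP => y /all_x; rewrite negbK.
exists x => //; rewrite (_ : s' = rcat t (nseq (4 + d) x)) //; apply: letters_inj.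
rewrite letters_rcat (all_pred1P _ _ s'x) [in RHS](all_pred1P _ _ tx) s'E.
by rewrite nseqD.
Qed.

Lemma moved_same_content s t : moved V s -> moved V t ->
  letters s =i letters t -> holds V s t.
Proof.
move=> Ms Mt st; have [y yt Vst] := moved_to_power Ms Mt st.
have [z zt Vtt] := moved_to_power Mt Mt (fun=> erefl).
apply: holds_trans Vst (holds_trans _ (holds_sym Vtt)).
by apply: moved_extensions => // x; rewrite mem_nseq => /eqP ->.
Qed.

(** If x occurs in p but not in q, substituting uv for x and u for the other
    letters in [p = q] relates words with the contents of uv and of u. *)
Lemma moved_connected p q s t : holds V p q -> ~ letters p =i letters q ->
  moved V s -> moved V t -> holds V s t.
Proof.
move=> Vpq0 neq Ms Mt.
have [{Vpq0 neq}p [{}q [x [Vpq xp xq]]]] := content_witness Vpq0 neq.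
have Mp : moved V p by exists q => // eq_qp; rewrite eq_qp xp in xq.
have moved_cat u v : moved V u -> moved V (catw u v).
  rewrite (_ : catw u v = plug [::] letter (letters v) u); first exact: moved_plug.
  by rewrite -rcat_plug; apply: letters_inj; rewrite letters_rcat.
suff join u v : moved V u -> moved V v -> holds V u (catw u v).
  apply: holds_trans (join s t Ms Mt) (holds_trans _ (holds_sym (join t s Mt Ms))).
  apply: moved_same_content; [exact: moved_cat|exact: moved_cat|move=> y].
  by rewrite !letters_catw !mem_cat orbC.
move=> Mu Mv; pose f y := if y == x then catw u v else u.
have Vf : holds V (subst f p) (subst f q) by rewrite -!plug_subst; apply: holds_plug.
have Mfp : moved V (subst f p) by rewrite -plug_subst; apply: moved_plug.
apply: holds_trans (holds_trans _ (holds_sym Vf)) _; apply: moved_same_content => //.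
- exact: moved_mate Mfp Vf.
- move=> y; apply/idP/mem_subst => [yu|[z zq]].
    exists q.1; first exact: mem_head.
    by rewrite /f; case: ifP => // _; rewrite letters_catw mem_cat yu.
  by rewrite /f; case: eqP zq => // ->; rewrite (negPf xq).
- exact: moved_cat.
move=> y; apply/mem_subst/idP => [[z zp]|yuv]; last by exists x; rewrite // /f eqxx.
by rewrite /f; case: eqP => // _ yu; rewrite letters_catw mem_cat yu.
Qed.

(** The 0-reduced part is the variety in which all moved words are 0. *)
Lemma lower_modular_decomposition : exists M N : variety,
  [/\ M = var_T \/ M = var_SL, zero_reduced N & V = (M `|` N)%O].
Proof.
have Nvar : is_variety (models (zero_identities (moved V))) by eexists.
pose N := Variety Nvar.
have N_holds p q : holds N p q <-> p = q \/ moved V p /\ moved V q.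
  have movedE w : ideal (moved V) w <-> moved V w.
    split=> [[g [f [h [t Mt ->]]]]|Mw]; first exact: moved_plug.
    by exists [::], letter, [::], w; rewrite ?plug_id.
  by rewrite (zero_variety_holds (W := moved V)) // !movedE.
have NV : (N <= V)%O.
  apply/levP => S NS; apply: in_variety => p q Vpq.
  suff : holds N p q by apply.
  apply/N_holds; have [->|neq] := pselect (p = q); [by left|right].
  split; first by exists q => //; apply: nesym.
  by exists p => //; apply: holds_sym.
have decompose M : (M <= V)%O ->
    (forall p q, holds M p q -> moved V p -> moved V q -> holds V p q) ->
    V = (M `|` N)%O.
  move=> MV MNV; apply/le_anti; rewrite leUx MV NV !andbT.
  apply/levP => S VS; apply/in_joinP => p q Mpq /N_holds[->//|[Mp Mq]].
  exact: MNV VS.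
have [Vcontent|] := pselect (forall p q, holds V p q -> letters p =i letters q).
  exists var_SL, N; split; [by right|by exists (moved V)|apply: decompose].
    apply/levP => S SLS; apply: in_variety => p q /Vcontent /var_SL_holds.
    by apply.
  by move=> p q /var_SL_holds pq Mp Mq; apply: moved_same_content.
move=> /existsNP[p] /existsNP[q] /not_implyP[Vpq neq].
exists var_T, N; split; [by left|by exists (moved V)|apply: decompose].
  by apply/levP => S ST; apply: in_variety => u v _ phi; apply: ST.
by move=> u v _; apply: moved_connected neq.
Qed.

End Necessity.

(** * The characterisation *)

Local Open Scope order_scope.

Theorem theorem1p1 (V : variety) :
  lower_modular V <->
  V = var_SEM \/
  exists M N : variety,
    [/\ M = var_T \/ M = var_SL, zero_reduced N & V = M `|` N].
Proof.
split=> [Vlm|[->|[M [N [ME /zero_reduced_lower_modular Nlm ->]]]]].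
- by right; apply: lower_modular_decomposition.
- by apply: lower_modular_of_le => Y Z _ S _ _; apply: (levP _ _ (leUl var_SEM _)).
apply: joinv_lower_modular => //; case: ME => ->; last exact: semilattice_lower_modular.
apply: lower_modular_of_le => Y Z _ S YS /in_joinP TZS.
apply/in_joinP => u v Tuv YZuv; apply: YZuv; split=> //.
apply: in_variety => p q Zpq; apply: TZS => //.
by move=> T TT phi; apply: TT.
Qed.
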